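(* Let $M\ge1$, let $\mathcal G=(S,E)$ be a path-complete graph on $\langle M\rangle$ satisfying the standing assumption, and let $T\ge1$ be an integer. Let $\mathcal P$ be the template of primal linear copositive norms and $\mathcal L$ the set of all $M$-tuples of nonnegative matrices. Then $$\mathcal G\le_{\mathcal P,\mathcal L}\mathcal G^{\oplus T}\qquad\text{and}\qquad \mathcal G\le_{\mathcal P,\mathcal L}\mathcal G_{\min}.$$
   Context: Graphs. $\langle M\rangle:=\{1,\dots,M\}$. A graph on $\langle M\rangle$ is a pair $\mathcal G=(S,E)$ with $S$ a finite nonempty set of nodes and $E\subseteq S\times S\times\langle M\rangle$ a set of directed labeled edges. $\mathcal G$ is path-complete if for every $K\ge1$ and every $(j_1,\dots,j_K)\in\langle M\rangle^K$ there are nodes $a_1,\dots,a_{K+1}$ with $(a_k,a_{k+1},j_k)\in E$ for $1\le k\le K$. Standing assumption on $\mathcal G$: $\mathcal G$ has one strongly connected component (it is strongly connected), and removing any edge from $\mathcal G$ destroys path-completeness. (The lifted graphs are not required to satisfy this.) Primal copositive norms. For $v\in\mathbb R^n_{>0}$, the primal linear copositive norm induced by $v$ is $g_v:\mathbb R^n_{\ge0}\to\mathbb R$, $g_v(x)=v^\top x$. $\mathcal P$ is the set of all such functions ($n\ge1$, $v\in\mathbb R^n_{>0}$). A nonnegative matrix is an $n\times n$ matrix with entries in $\mathbb R_{\ge0}$; $\mathcal L$ is the set of all $M$-tuples $(A_1,\dots,A_M)$ of nonnegative matrices of a common size $n\times n$, for all $n\ge1$. Order relation. For path-complete graphs $\mathcal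 G=(S,E)$, $\widetilde{\mathcal G}=(\widetilde S,\widetilde E)$ on $\langle M\rangle$, $\mathcal G\le_{\mathcal P,\mathcal L}\widetilde{\mathcal G}$ means: for every $n$ and every $(A_1,\dots,A_M)\in\mathcal L$ of size $n\times n$, if there are functions $V_s\in\mathcal P$ on $\mathbb R^n_{\ge0}$ ($s\in S$) with $V_b(A_ix)\le V_a(x)$ for all $(a,b,i)\in E$ and all $x\in\mathbb R^n_{\ge0}$, then there are functions $W_s\in\mathcal P$ on $\mathbb R^n_{\ge0}$ ($s\in\widetilde S$) with $W_b(A_ix)\le W_a(x)$ for all $(a,b,i)\in\widetilde E$ and all $x\in\mathbb R^n_{\ge0}$. The relation includes that both graphs are path-complete. Lifts of $\mathcal G=(S,E)$. - $T$-sum lift $\mathcal G^{\oplus T}$: nodes are the multisets of cardinality $T$ with elements in $S$; the edges are $(\{a_1,\dots,a_T\},\{b_1,\dots,b_T\},i)$ for each label $i$ and each multiset of $T$ edges $\{(a_1,b_1,i),\dots,(a_T,b_T,i)\}$ of $E$ (all with label $i$, repetitions allowed). - Min lift $\mathcal G_{\min}$: nodes are the nonempty subsets of $S$; $(A,B,i)$ is an edge iff for all $a\in A$ there is $b\in B$ with $(a,b,i)\in E$. *)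

(* Defs.v *)
From HB Require Import structures.
From mathcomp Require Import all_boot all_order all_algebra.
From mathcomp Require Import finmap multiset.
From mathcomp Require Import reals.

Set Implicit Arguments.
Unset Strict Implicit.
Unset Printing Implicit Defensive.

Import Order.TTheory GRing.Theory Num.Theory.

Local Open Scope mset_scope.
Local Open Scope nat_scope.

(* The label set {1, ..., M} is represented by 'I_M = {0, ..., M-1}. *)
Record graph (M : nat) := Graph {
  node : finType;
  edges : {set node * node * 'I_M};
  node_nonempty : 0 < #|node|
}.

Section Graphs.
Variable M : nat.
Implicit Type G : graph M.

Definition path_complete G : Prop :=
  forall (K : nat) (j : 'I_K -> 'I_M), 0 < K ->
  exists a : 'I_K.+1 -> node G, forall k : 'I_K,
    (a (widen_ord (leqnSn K) k), a (lift ord0 k), j k) \in edges G.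

Definition adjacent G : rel (node G) :=
  fun a b => [exists i : 'I_M, (a, b, i) \in edges G].

Definition strongly_connected G : Prop :=
  forall a b : node G, connect (@adjacent G) a b.

Definition remove_edge G (e : node G * node G * 'I_M) : graph M :=
  Graph (edges G :\ e) (node_nonempty G).

Definition edge_minimal G : Prop :=
  forall e, e \in edges G -> ~ path_complete (remove_edge e).

End Graphs.

Section MultisetsOfGivenCard.
Variables (S : finType) (T : nat).

(* [size A] counts the elements of [A] with multiplicity. *)
Record msetn := MSetn { msetn_val :> {mset S}; _ : size msetn_val == T }.

HB.instance Definition _ := [isSub for msetn_val].
HB.instance Definition _ := [Choice of msetn by <:].

Lemma size_msetn (A : msetn) : size A == T.
Proof. exact: (valP A). Qed.

Lemma size_seq_msetn (t : T.-tuple S) : size (seq_mset t) == T.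
Proof. by rewrite (perm_size (perm_eq_seq_mset t)) size_tuple. Qed.

Definition msetn_of_tuple (t : T.-tuple S) : msetn := MSetn (size_seq_msetn t).

Definition tuple_of_msetn (A : msetn) : T.-tuple S := Tuple (size_msetn A).

Lemma tuple_of_msetnK : cancel tuple_of_msetn msetn_of_tuple.
Proof. by move=> A; apply: val_inj; rewrite /= seq_mset_id. Qed.

HB.instance Definition _ := Countable.copy msetn (can_type tuple_of_msetnK).
HB.instance Definition _ : isFinite msetn := CanIsFinite tuple_of_msetnK.

Lemma card_msetn_gt0 : 0 < #|S| -> 0 < #|{: msetn}|.
Proof.
by case/card_gt0P=> s _; apply/card_gt0P; exists (msetn_of_tuple [tuple of nseq T s]).
Qed.

End MultisetsOfGivenCard.

Section Lifts.
Variables (M : nat) (G : graph M).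

(* A multiset of T edges with common label i is listed as a pair of T-tuples
   a, b with (a_k, b_k, i) an edge for every k; the resulting edge does not
   depend on the order of the list. *)
Definition sum_lift (T : nat) : graph M :=
  @Graph M (msetn (node G) T)
    [set e | [exists a : T.-tuple (node G), exists b : T.-tuple (node G),
       [&& [forall k : 'I_T, (tnth a k, tnth b k, e.2) \in edges G],
           e.1.1 == msetn_of_tuple a & e.1.2 == msetn_of_tuple b]]]
    (card_msetn_gt0 T (node_nonempty G)).

Definition nonempty_subset : finType := {A : {set node G} | A != set0}.

Lemma card_nonempty_subset_gt0 : 0 < #|nonempty_subset|.
Proof.
case/card_gt0P: (node_nonempty G) => s _.
have s0 : [set s] != set0 by apply/set0Pn; exists s; rewrite inE.
by apply/card_gt0P; exists (exist _ [set s] s0).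
Qed.

Definition min_lift : graph M :=
  @Graph M nonempty_subset
    [set e : nonempty_subset * nonempty_subset * 'I_M |
       [forall a in val e.1.1, exists b in val e.1.2,
          (a, b, e.2) \in edges G]]
    card_nonempty_subset_gt0.

End Lifts.

Local Open Scope ring_scope.

Section Order.
Variable R : realType.

Definition orthant n (x : 'cV[R]_n) : Prop := forall k, 0 <= x k 0.

Definition primal_norm n (v x : 'cV[R]_n) : R := (v^T *m x) 0 0.

(* A function on the nonnegative orthant is represented by a total function on
   column vectors, of which only the values on the orthant matter. *)
Definition primal_template n (g : 'cV[R]_n -> R) : Prop :=
  exists v : 'cV[R]_n, (forall k, 0 < v k 0) /\
    forall x, orthant x -> g x = primal_norm v x.

Definition nonneg_tuple M n (A : 'I_M -> 'M[R]_n) : Prop :=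
  forall i k l, 0 <= A i k l.

Definition template := forall n, ('cV[R]_n -> R) -> Prop.
Definition systems M := forall n, ('I_M -> 'M[R]_n) -> Prop.

Definition admissible (P : template) M (G : graph M) n
    (A : 'I_M -> 'M[R]_n) : Prop :=
  exists V : node G -> 'cV[R]_n -> R,
    (forall s, P n (V s)) /\
    (forall a b i, (a, b, i) \in edges G ->
       forall x, orthant x -> V b (A i *m x) <= V a x).

Definition graph_le M (P : template) (L : systems M) (G H : graph M) : Prop :=
  [/\ path_complete G, path_complete H &
      forall n (A : 'I_M -> 'M[R]_n), (0 < n)%N -> L n A ->
        admissible P G A -> admissible P H A].

End Order.

(* Main.v *)
(** In terms of the weight vectors, the inequality attached to an edge (a, b, i)
    is [A_i^T v_b <= v_a] entrywise.  Such inequalities can be added, so the sum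
    of the weights over a multiset works for the T-sum lift; and since [A_i^T]
    is monotone, the entrywise minimum of the weights over a subset works for
    the min lift. *)
Require Import Defs.
From mathcomp Require Import all_boot all_order all_algebra.
From mathcomp Require Import finmap multiset.
From mathcomp Require Import reals.

Set Implicit Arguments.
Unset Strict Implicit.
Unset Printing Implicit Defensive.

Import Order.TTheory GRing.Theory Num.Theory.

Local Open Scope mset_scope.
Local Open Scope ring_scope.

(** Each lift receives a homomorphism from [G]: to constant multisets for the sum lift, to
    singletons for the min lift. *)
Lemma path_complete_hom M (G H : graph M) (f : node G -> node H) :
    (forall a b i, (a, b, i) \in edges G -> (f a, f b, i) \in edges H) ->
  path_complete G -> path_complete H.
Proof.
move=> fE Gpc K j K_gt0; have [a aE] := Gpc K j K_gt0.
by exists (f \o a) => k; apply/fE/aE.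
Qed.

Lemma path_complete_sum_lift M (G : graph M) T :
  path_complete G -> path_complete (sum_lift G T).
Proof.
apply: (path_complete_hom
  (f := fun s => msetn_of_tuple [tuple of nseq T s] : node (sum_lift G T))).
move=> a b i abE; rewrite inE /=.
apply/existsP; exists [tuple of nseq T a].
apply/existsP; exists [tuple of nseq T b].
by rewrite !eqxx !andbT; apply/forallP => k; rewrite !tnth_nseq.
Qed.

Lemma set1_neq0 (S : finType) (s : S) : [set s] != set0.
Proof. by apply/set0Pn; exists s; rewrite inE. Qed.

Lemma path_complete_min_lift M (G : graph M) :
  path_complete G -> path_complete (min_lift G).
Proof.
apply: (path_complete_hom
  (f := fun s => exist _ [set s] (set1_neq0 s) : node (min_lift G))).
move=> a b i abE; rewrite inE /=; apply/forall_inP => _ /set1P->.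
by apply/exists_inP; exists b; rewrite ?inE.
Qed.

Section Admissible.
Variables (R : realType) (M n : nat) (A : 'I_M -> 'M[R]_n).
Hypothesis A_ge0 : nonneg_tuple A.

Definition admissible_weights (G : graph M) (v : node G -> 'cV[R]_n) : Prop :=
  (forall s k, 0 < v s k 0) /\
  (forall a b i, (a, b, i) \in edges G ->
     forall k, ((A i)^T *m v b) k 0 <= v a k 0).

Lemma primal_normE (v x : 'cV[R]_n) :
  primal_norm v x = \sum_k v k 0 * x k 0.
Proof. by rewrite /primal_norm mxE; apply: eq_bigr => k _; rewrite mxE. Qed.

Lemma primal_norm_delta (v : 'cV[R]_n) k :
  primal_norm v (delta_mx k 0) = v k 0.
Proof. by rewrite /primal_norm -colE !mxE. Qed.

Lemma primal_norm_mulmx (v x : 'cV[R]_n) i :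
  primal_norm v (A i *m x) = primal_norm ((A i)^T *m v) x.
Proof. by rewrite /primal_norm trmx_mul trmxK mulmxA. Qed.

Lemma orthant_mulmx i (x : 'cV[R]_n) : orthant x -> orthant (A i *m x).
Proof.
by move=> x_ge0 k; rewrite mxE; apply: sumr_ge0 => l _; apply: mulr_ge0.
Qed.

(** Testing an edge inequality on the basis vectors yields its entrywise form; conversely, the
    entrywise form is summed against the nonnegative coordinates of [x]. *)
Lemma admissible_primalP (G : graph M) :
  admissible (@primal_template R) G A <->
  exists v : node G -> 'cV[R]_n, admissible_weights v.
Proof.
split=> [[V [VP VE]] | [v [v_gt0 vE]]].
  have [v vP] := fin_all_exists VP.
  exists v; split=> [s | a b i abE k]; first by have [] := vP s.
  have d_ge0 : orthant (delta_mx k 0 : 'cV[R]_n).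
    by move=> l; rewrite mxE ler0n.
  have := VE _ _ _ abE _ d_ge0.
  (* [V b] is known to be linear only on the orthant, so nonnegativity of [A i] is what allows it to
     be expanded at the image of the basis vector. *)
  rewrite (vP a).2 // (vP b).2; last exact: orthant_mulmx.
  by rewrite primal_norm_mulmx !primal_norm_delta.
exists (fun s => primal_norm (v s)); split=> [s | a b i abE x x_ge0].
  by exists (v s).
rewrite primal_norm_mulmx !primal_normE; apply: ler_sum => k _.
by apply: ler_wpM2r; [exact: x_ge0 | exact: vE].
Qed.

Lemma admissible_weights_sum_lift (G : graph M) (v : node G -> 'cV[R]_n) T :
    (0 < T)%N -> admissible_weights v ->
  admissible_weights
    (fun B : node (sum_lift G T) => \sum_(s <- (B : {mset node G})) v s).
Proof.
move=> T_gt0 [v_gt0 vE].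
(* The sum can be taken along any listing, in particular along the two matched tuples that witness
   an edge of the lift. *)
have sum_tuple (t : T.-tuple (node G)) :
    \sum_(s <- msetn_of_tuple t : {mset node G}) v s =
    \sum_(k < T) v (tnth t k).
  by rewrite (perm_big _ (perm_eq_seq_mset t)) big_tuple.
split=> [B k | B C i].
  rewrite -(tuple_of_msetnK B) sum_tuple summxE.
  (* Strict positivity needs at least one summand: the empty sum would be zero. *)
  case: T T_gt0 B {sum_tuple} => // T _ B.
  rewrite big_ord_recl; apply: ltr_pwDl; first exact: v_gt0.
  by apply: sumr_ge0 => l _; apply: ltW.
rewrite inE => /existsP[a /existsP[b /and3P[/forallP/= abE /eqP-> /eqP->]]] k.
rewrite !sum_tuple mulmx_sumr !summxE; apply: ler_sum => l _.
exact: vE (abE l) k.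
Qed.

Lemma admissible_weights_min_lift (G : graph M) (v : node G -> 'cV[R]_n) :
    admissible_weights v ->
  exists w : node (min_lift G) -> 'cV[R]_n, admissible_weights w.
Proof.
move=> [v_gt0 vE].
(* The iterated minimum needs a default value; taking it from a member of [B] leaves the true
   minimum over [B] unchanged. *)
pose rep (B : node (min_lift G)) := xchoose (set0Pn _ (valP B)).
have repP B : rep B \in val B by apply: xchooseP.
pose w (B : node (min_lift G)) : 'cV[R]_n :=
  \col_k \big[Num.min/v (rep B) k 0]_(s in val B) v s k 0.
exists w; split=> [B k | B C i].
  by rewrite mxE; apply: lt_bigmin => [|s _]; apply: v_gt0.
rewrite inE => /forall_inP/= BCE k; rewrite [leRHS]mxE.
(* For the successor [b] of [a] in [C], [w C] lies entrywise below [v b], and multiplying by the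
   nonnegative matrix [(A i)^T] preserves this. *)
have le_v a : a \in val B -> ((A i)^T *m w C) k 0 <= v a k 0.
  move=> /BCE /exists_inP[b bC abE]; apply: le_trans (vE _ _ _ abE k).
  rewrite !mxE; apply: ler_sum => l _; apply: ler_wpM2l; first by rewrite mxE.
  by rewrite mxE; apply: bigmin_le_cond.
(* The default value must be bounded as well; it is the case [a = rep B]. *)
by apply: le_bigmin => [|a]; apply: le_v.
Qed.

End Admissible.

Theorem theorem6 (R : realType) (M : nat) (hM : (1 <= M)%N) (G : graph M)
    (hG : path_complete G) (hconn : strongly_connected G)
    (hmin : edge_minimal G) (T : nat) (hT : (1 <= T)%N) :
  graph_le (@primal_template R) (@nonneg_tuple R M) G (sum_lift G T) /\
  graph_le (@primal_template R) (@nonneg_tuple R M) G (min_lift G).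
Proof.
split; split=> //.
- exact: path_complete_sum_lift.
- move=> n A _ A_ge0 /(admissible_primalP A_ge0)[v vE].
  apply/(admissible_primalP A_ge0).
  by eexists; apply: admissible_weights_sum_lift vE.
- exact: path_complete_min_lift.
- move=> n A _ A_ge0 /(admissible_primalP A_ge0)[v vE].
  apply/(admissible_primalP A_ge0).
  exact: admissible_weights_min_lift vE.
Qed.
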